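(* Let $R$ be any ring (with identity, not necessarily commutative) and let $X$ be a locally finite partially ordered set with no minimal elements, i.e. $\mathrm{Min}(X)=\emptyset$. Then $\mathrm{Soc}_l(I(X,R))=\{0\}$.
   Context: A partially ordered set $X$ is locally finite if every interval $[x,y]=\{z\in X: x\le z\le y\}$ is finite. $\mathrm{Min}(X)$ is the set of minimal elements of $X$. The incidence ring $I(X,R)$ is the set of functions $f:X\times X\to R$ with $f(x,y)=0$ unless $x\le y$, with pointwise addition and product $(fg)(x,y)=\sum_{x\le z\le y} f(x,z)g(z,y)$. For a ring $A$, the left socle $\mathrm{Soc}_l(A)$ is the sum of all minimal left ideals of $A$. *)

(* Defs.v *)
From HB Require Import structures.
From mathcomp Require Import all_boot all_order all_algebra.
From mathcomp Require Import finmap.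
From mathcomp Require Import boolp classical_sets functions cardinality fsbigop.
From mathcomp Require Import set_interval.

Set Implicit Arguments.
Unset Strict Implicit.
Unset Printing Implicit Defensive.

Import Order.TTheory GRing.Theory.

Local Open Scope classical_set_scope.
Local Open Scope ring_scope.

Section Poset.
Context {d : Order.disp_t} (X : porderType d).

Definition locally_finite := forall x y : X, finite_set `[x, y].

Definition Min : set X := [set x | forall y : X, (y <= x)%O -> y = x].

End Poset.
Arguments locally_finite {d} X.
Arguments Min {d} X.

Section LeftSocle.
Context {A : pzRingType}.

Definition left_ideal (I : set A) :=
  [/\ I 0, forall u v, I u -> I v -> I (u - v) & forall a u, I u -> I (a * u)].

Definition minimal_left_ideal (I : set A) :=
  [/\ left_ideal I, I <> [set 0] &
      forall J, left_ideal J -> J `<=` I -> J = [set 0] \/ J = I].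

(* The sum of a family of left ideals consists of the finite sums of elements
   of its members; the sum of the empty family is [set 0]. *)
Definition ideal_sum (F : set (set A)) : set A :=
  [set x | exists n (u : 'I_n -> A),
     (forall i, exists2 I, F I & I (u i)) /\ x = \sum_(i < n) u i].

End LeftSocle.

Definition left_socle (A : pzRingType) : set A :=
  ideal_sum (@minimal_left_ideal A).
Arguments left_socle A : clear implicits.

(* The proof of local finiteness is a parameter of the type so that the ring
   structure below can be inferred. *)
Record incidence d (X : porderType d) (lfX : locally_finite X)
    (R : pzRingType) := Incidence {
  incidence_fun :> X -> X -> R;
  incidence_supp : forall x y, ~~ (x <= y)%O -> incidence_fun x y = 0 }.

Section IncidenceRing.
Context {d : Order.disp_t} {X : porderType d} {lfX : locally_finite X}.
Context {R : pzRingType}.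
Local Notation I := (incidence lfX R).
Implicit Types f g h : I.

Lemma incidenceP f g : (forall x y, f x y = g x y) -> f = g.
Proof.
case: f g => [f f0] [g g0] /= fg.
have {}fg : f = g by apply/funext => x; apply/funext => y.
by case: g / fg g0 => g0; congr Incidence; exact: Prop_irrelevance.
Qed.

HB.instance Definition _ := gen_eqMixin I.
HB.instance Definition _ := gen_choiceMixin I.

Fact incidence_zero_supp (x y : X) : ~~ (x <= y)%O -> 0 = 0 :> R.
Proof. by []. Qed.
Definition incidence_zero : I := Incidence lfX incidence_zero_supp.

Fact incidence_opp_supp f x y : ~~ (x <= y)%O -> - f x y = 0.
Proof. by move=> /incidence_supp ->; rewrite oppr0. Qed.
Definition incidence_opp f : I := Incidence lfX (incidence_opp_supp f).

Fact incidence_add_supp f g x y : ~~ (x <= y)%O -> f x y + g x y = 0.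
Proof. by move=> xy; rewrite !incidence_supp// addr0. Qed.
Definition incidence_add f g : I := Incidence lfX (incidence_add_supp f g).

Fact incidence_addA : associative incidence_add.
Proof. by move=> f g h; apply: incidenceP => x y /=; rewrite addrA. Qed.
Fact incidence_addC : commutative incidence_add.
Proof. by move=> f g; apply: incidenceP => x y /=; rewrite addrC. Qed.
Fact incidence_add0 : left_id incidence_zero incidence_add.
Proof. by move=> f; apply: incidenceP => x y /=; rewrite add0r. Qed.
Fact incidence_addN : left_inverse incidence_zero incidence_opp incidence_add.
Proof. by move=> f; apply: incidenceP => x y /=; rewrite addNr. Qed.

HB.instance Definition _ := GRing.isZmodule.Build I
  incidence_addA incidence_addC incidence_add0 incidence_addN.

Fact incidence_one_supp (x y : X) : ~~ (x <= y)%O -> (x == y)%:R = 0 :> R.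
Proof. by case: eqVneq => // ->; rewrite lexx. Qed.
Definition incidence_one : I := Incidence lfX incidence_one_supp.

Fact incidence_mul_supp f g x y :
  ~~ (x <= y)%O -> \sum_(z \in `[x, y]) f x z * g z y = 0.
Proof.
move=> xy; apply: fsbig1 => z; rewrite /= in_itv /= => /andP[xz zy].
by rewrite (le_trans xz zy) in xy.
Qed.
Definition incidence_mul f g : I := Incidence lfX (incidence_mul_supp f g).

Lemma incidence_mulE f g x y (s : seq X) : uniq s ->
  (forall z, (x <= z <= y)%O -> z \in s) ->
  incidence_mul f g x y = \sum_(z <- s) f x z * g z y.
Proof.
move=> us xys; apply: fsbig_fwiden => // z; rewrite /= in_itv /=.
case=> _ /negP; rewrite negb_and => /orP[] zN.
  by rewrite (incidence_supp f zN) mul0r.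
by rewrite (incidence_supp g zN) mulr0.
Qed.

Definition itv_seq (x y : X) : seq X := fset_set `[x, y].

Lemma itv_seq_uniq x y : uniq (itv_seq x y).
Proof. exact: fset_uniq. Qed.

Lemma mem_itv_seq x y z : (z \in itv_seq x y) = (x <= z <= y)%O.
Proof. by rewrite in_fset_set ?mem_setE ?in_itv. Qed.

Fact incidence_mulA : associative incidence_mul.
Proof.
move=> f g h; apply: incidenceP => x y; set s := itv_seq x y.
have us : uniq s := itv_seq_uniq x y.
rewrite !(@incidence_mulE _ _ x y s)//; try by move=> z; rewrite mem_itv_seq.
transitivity (\sum_(z <- s) \sum_(t <- s) f x z * (g z t * h t y)).
  apply: eq_big_seq => z; rewrite mem_itv_seq => /andP[xz _].
  rewrite (@incidence_mulE _ _ z y s) ?mulr_sumr// => t /andP[zt ty].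
  by rewrite mem_itv_seq ty (le_trans xz zt).
rewrite exchange_big; apply: eq_big_seq => t; rewrite mem_itv_seq => /andP[_ ty].
rewrite (@incidence_mulE _ _ x t s) ?mulr_suml//; last first.
  by move=> z /andP[xz zt]; rewrite mem_itv_seq xz (le_trans zt ty).
by apply: eq_bigr => z _; rewrite mulrA.
Qed.

Fact incidence_mul1l : left_id incidence_one incidence_mul.
Proof.
move=> f; apply: incidenceP => x y.
have [xy|xy] := boolP (x <= y)%O; last by rewrite !incidence_supp.
rewrite (@incidence_mulE _ _ x y (itv_seq x y)) ?itv_seq_uniq//; last first.
  by move=> z; rewrite mem_itv_seq.
rewrite (bigD1_seq x) ?itv_seq_uniq ?mem_itv_seq ?lexx//= eqxx mul1r.
by rewrite big1 ?addr0// => z zx; rewrite eq_sym (negPf zx) mul0r.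
Qed.

Fact incidence_mul1r : right_id incidence_one incidence_mul.
Proof.
move=> f; apply: incidenceP => x y.
have [xy|xy] := boolP (x <= y)%O; last by rewrite !incidence_supp.
rewrite (@incidence_mulE _ _ x y (itv_seq x y)) ?itv_seq_uniq//; last first.
  by move=> z; rewrite mem_itv_seq.
rewrite (bigD1_seq y) ?itv_seq_uniq ?mem_itv_seq ?lexx ?xy//= eqxx mulr1.
by rewrite big1 ?addr0// => z zy; rewrite (negPf zy) mulr0.
Qed.

Fact incidence_mulDl : left_distributive incidence_mul +%R.
Proof.
move=> f g h; apply: incidenceP => x y; set s := itv_seq x y.
have us : uniq s := itv_seq_uniq x y.
transitivity (incidence_mul f h x y + incidence_mul g h x y); last by [].
rewrite !(@incidence_mulE _ _ x y s)//; try by move=> z; rewrite mem_itv_seq.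
by rewrite -big_split; apply: eq_bigr => z _; rewrite mulrDl.
Qed.

Fact incidence_mulDr : right_distributive incidence_mul +%R.
Proof.
move=> f g h; apply: incidenceP => x y; set s := itv_seq x y.
have us : uniq s := itv_seq_uniq x y.
transitivity (incidence_mul f g x y + incidence_mul f h x y); last by [].
rewrite !(@incidence_mulE _ _ x y s)//; try by move=> z; rewrite mem_itv_seq.
by rewrite -big_split; apply: eq_bigr => z _; rewrite mulrDr.
Qed.

HB.instance Definition _ := GRing.Zmodule_isPzRing.Build I
  incidence_mulA incidence_mul1l incidence_mul1r incidence_mulDl incidence_mulDr.

End IncidenceRing.

(* Main.v *)
Require Import Defs.
From mathcomp Require Import all_boot all_order all_algebra.
From mathcomp Require Import classical_sets.
From mathcomp Require Import boolp.

Import Order.TTheory GRing.Theory.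

Local Open Scope classical_set_scope.
Local Open Scope ring_scope.

(* Let f be a nonzero element of a minimal left ideal L, say f(x,y) <> 0, and
   choose w < x. With e the matrix unit at (w,x), the element h = e f of L has
   its support in row w and h(w,y) = f(x,y) <> 0, so minimality makes L the
   principal left ideal generated by h. But (a h)(x,y) = a(x,w) h(w,y) = 0 for
   all a since x </= w, contradicting f = a h. So there are no minimal left
   ideals. *)

Lemma principal_left_ideal (A : pzRingType) (h : A) :
  left_ideal [set a * h | a in setT].
Proof.
split.
- by exists 0 => //; rewrite mul0r.
- by move=> _ _ [a _ <-] [b _ <-]; exists (a - b) => //; rewrite mulrBl.
- by move=> a _ [b _ <-]; exists (a * b) => //; rewrite mulrA.
Qed.

(** The principal left ideal of [h] lies in [L] and contains [h = 1 * h], so it is nonzero and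
    minimality forces it to be [L]. *)
Lemma minimal_left_ideal_generated (A : pzRingType) (L : set A) (h u : A) :
  minimal_left_ideal L -> L h -> h <> 0 -> L u -> exists a, u = a * h.
Proof.
move=> [[_ _ LM] _ Lmin] Lh h0 Lu.
have JL : [set a * h | a in setT] `<=` L by move=> _ [a _ <-]; exact: LM.
have [J0|JE] := Lmin _ (principal_left_ideal _ h) JL.
- have : [set a * h | a in setT] h by exists 1; rewrite ?mul1r.
  by rewrite J0.
- by move: Lu; rewrite -JE => -[a _ <-]; exists a.
Qed.

Lemma left_ideal_neq0 (A : pzRingType) (L : set A) :
  left_ideal L -> L <> [set 0] -> exists2 u, L u & u <> 0.
Proof.
move=> [L0 _ _] Ln0; apply: contrapT => /forall2NP Lz; apply: Ln0.
apply/seteqP; split=> [u Lu|_ ->//].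
by case: (Lz u) => // /contrapT.
Qed.

Section IncidenceRing.
Context {d : Order.disp_t} {X : porderType d} {lfX : locally_finite X}.
Context {R : pzRingType}.
Local Notation I := (incidence lfX R).

Lemma incidence_neq0 (f : I) : f <> 0 -> exists x y, f x y <> 0.
Proof.
move=> f0; apply: contrapT => /forallNP fz; apply: f0.
apply: incidenceP => x y; apply: contrapT => fxy.
by apply: (fz x); exists y.
Qed.

(** Passing from the set [[x, y]] to a duplicate-free list allows single terms to be split off. *)
Lemma incidence_mul_itvE (f g : I) x y :
  (f * g) x y = \sum_(z <- itv_seq x y) f x z * g z y.
Proof.
by apply: incidence_mulE => [|z]; rewrite ?itv_seq_uniq ?mem_itv_seq.
Qed.

Fact matrix_unit_supp (w x : X) : (w <= x)%O -> forall y z,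
  ~~ (y <= z)%O -> ((y == w) && (z == x))%:R = 0 :> R.
Proof.
move=> wx y z; case: eqVneq => //= ->; case: eqVneq => //= ->.
by rewrite wx.
Qed.

Definition matrix_unit (w x : X) (wx : (w <= x)%O) : I :=
  Incidence lfX (matrix_unit_supp w x wx).

Lemma matrix_unit_mulE (w x : X) (wx : (w <= x)%O) (f : I) z y :
  (matrix_unit w x wx * f) z y = if z == w then f x y else 0.
Proof.
rewrite incidence_mul_itvE /=; case: (eqVneq z w) => [->|zw]; last first.
  by rewrite big1// => t _; rewrite mul0r.
(* If [x <= y] fails, [x] is not in [itv_seq w y] and cannot be split off, but then [f x y = 0] and
   every term vanishes. *)
have [xy|xy] := boolP (x <= y)%O; last first.
  rewrite (incidence_supp f xy) big1// => t _.
  by case: eqVneq => [->|_]; rewrite ?(incidence_supp f xy) ?mulr0 ?mul0r.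
rewrite (bigD1_seq x) ?itv_seq_uniq ?mem_itv_seq ?wx//= eqxx mul1r.
by rewrite big1 ?addr0// => t /negPf ->; rewrite mul0r.
Qed.

Lemma incidence_no_minimal_left_ideal (L : set I) :
  Min X = set0 -> ~ minimal_left_ideal L.
Proof.
move=> minX Lmin; have [Lid Ln0 _] := Lmin.
have [f Lf /incidence_neq0[x [y fxy]]] := left_ideal_neq0 _ _ Lid Ln0.
have [w wx wnx] : exists2 w, (w <= x)%O & w <> x.
  apply: contrapT => /forall2NP nw.
  suff : Min X x by rewrite minX.
  by move=> w wx; case: (nw w) => // /contrapT.
pose h : I := matrix_unit w x wx * f.
have Lh : L h by case: Lid => _ _; apply.
have h0 : h <> 0.
  move=> /(congr1 (fun g : I => g w y)).
  by rewrite matrix_unit_mulE eqxx.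
have [a fE] := minimal_left_ideal_generated _ _ h f Lmin Lh h0 Lf.
(* Only [z = w] could contribute, as [h] lives in row [w]; but [z] ranges over elements above [x],
   and [x <= w] would give [w = x]. *)
apply: fxy; rewrite fE incidence_mul_itvE big1_seq// => z.
rewrite andTb (mem_itv_seq (lfX := lfX)) => /andP[xz _].
rewrite matrix_unit_mulE; case: eqVneq => [zw|_]; last by rewrite mulr0.
by case: wnx; apply/le_anti; rewrite wx -zw.
Qed.

End IncidenceRing.

Theorem proposition3p0p5 (R : pzRingType) (d : Order.disp_t)
    (X : porderType d) (lfX : locally_finite X) (minX : Min X = set0) :
  left_socle (incidence lfX R) = [set 0].
Proof.
apply/seteqP; split=> [u [n [v [vL ->]]]|_ ->]; last first.
  (* The empty sum gives 0 without any minimal left ideal. *)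
  by exists 0, (fun=> 0); split; [case|rewrite big_ord0].
(* Each summand comes with a minimal left ideal containing it, which is absurd. *)
apply: big1 => i _; have [L Lmin _] := vL i.
by case: (incidence_no_minimal_left_ideal L minX Lmin).
Qed.
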